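(* Let $f:\mathbb{R}^n\times\{0,1\}^b\times\mathbf{W}\to\mathbb{R}^r$ be the mixed-integer convex constraint function of the chance constrained program $$\min_{(\mathbf{x},\mathbf{y})\in\mathbf{V}} c^\top\mathbf{x}\quad\text{subject to}\quad \mathbb{P}[f(\mathbf{x},\mathbf{y},\mathbf{w})\le 0]\ge 1-\epsilon,$$ and let $\mathcal{J}=\{1,\dots,r\}$. The support rank function $\rho:2^{\mathcal{J}}\to\mathbb{N}$ associated with $f$ is monotone submodular, i.e. $\rho(\mathcal{A})\le\rho(\mathcal{B})$ for all $\mathcal{A}\subseteq\mathcal{B}\subseteq\mathcal{J}$, and $\rho(\mathcal{A}\cup\{j\})-\rho(\mathcal{A})\ge\rho(\mathcal{B}\cup\{j\})-\rho(\mathcal{B})$ for all $\mathcal{A}\subseteq\mathcal{B}\subset\mathcal{J}$ and $j\in\mathcal{J}\setminus\mathcal{B}$.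
   Context: Setting. $\mathbf{V}\subseteq\mathbb{R}^n\times\{0,1\}^b$ is compact and convex for fixed $\mathbf{y}$; $c\in\mathbb{R}^n$; $\epsilon\in(0,1)$; $\mathbf{w}$ is an uncertain parameter defined over a probability space $(\mathbf{W},\mathcal{F},\mathbb{P})$; $f$ has components $f_1,\dots,f_r$ (finite-valued) and is convex in $\mathbf{x}$ for all $\mathbf{w}\in\mathbf{W}$ and all $\mathbf{y}\in\mathbf{Y}:=\{\mathbf{y}\in\{0,1\}^b:\exists\mathbf{x}\in\mathbb{R}^n,\ (\mathbf{x},\mathbf{y})\in\mathbf{V}\}$. Support rank. Let $\mathcal{L}$ be the set of all linear subspaces of $\mathbb{R}^n$. For a function $g(\mathbf{x},\mathbf{y},\mathbf{w})$ on $\mathbb{R}^n\times\{0,1\}^b\times\mathbf{W}$ let $F_g(\mathbf{x},\mathbf{y},\mathbf{w}):=\{\xi\in\mathbb{R}^n: g(\mathbf{x}+\xi,\mathbf{y},\mathbf{w})=g(\mathbf{x},\mathbf{y},\mathbf{w})\}$ and $\mathcal{L}_g:=\bigcap_{(\mathbf{x},\mathbf{y},\mathbf{w})\in\mathbf{V}\times\mathbf{W}}\{L\in\mathcal{L}: L\subseteq F_g(\mathbf{x},\mathbf{y},\mathbf{w})\}$. For $\mathcal{A}\subseteq\mathcal{J}$, $L_{\mathcal{A}}$ is the maximal (with respect to inclusion) element of $\mathcal{L}_g$ with $g=\max_{j\in\mathcal{A}}f_j$, and the support rank is $\rho(\mathcal{A}):=n-\dim(L_{\mathcal{A}})$. For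 $\mathcal{A}=\emptyset$ the maximum is the constant $-\infty$, so $L_\emptyset=\mathbb{R}^n$ and $\rho(\emptyset)=0$. *)

(* Defs.v *)
From HB Require Import structures.
From mathcomp Require Import all_boot all_order all_algebra.
From mathcomp Require Import all_classical all_reals all_analysis.

Set Implicit Arguments.
Unset Strict Implicit.
Unset Printing Implicit Defensive.

Import Order.TTheory GRing.Theory Num.Theory.
Import numFieldNormedType.Exports.

Local Open Scope classical_set_scope.
Local Open Scope ring_scope.

(* {0,1}^b is 'cV[bool]_b, with the product topology of the discrete space bool.
   The set of binary vectors y admitting some x with (x, y) in V: *)
Definition binary_part (R : realType) (n b : nat)
    (V : set ('cV[R]_n * 'cV[bool]_b)) : set 'cV[bool]_b :=
  [set y | exists x, V (x, y)].

Definition flat_set (R : realType) (n b : nat) (W : Type)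
    (g : 'cV[R]_n -> 'cV[bool]_b -> W -> \bar R)
    (x : 'cV[R]_n) (y : 'cV[bool]_b) (w : W) : set 'cV[R]_n :=
  [set xi | g (x + xi) y w = g x y w].

Definition flat_subspaces (R : realType) (n b : nat) (W : Type)
    (V : set ('cV[R]_n * 'cV[bool]_b))
    (g : 'cV[R]_n -> 'cV[bool]_b -> W -> \bar R) : set {vspace 'cV[R]_n} :=
  \bigcap_(z in V `*` [set: W])
    [set L | [set` L] `<=` flat_set g z.1.1 z.1.2 z.2].

Definition max_flat (R : realType) (n b : nat) (W : Type)
    (V : set ('cV[R]_n * 'cV[bool]_b))
    (g : 'cV[R]_n -> 'cV[bool]_b -> W -> \bar R) : set {vspace 'cV[R]_n} :=
  [set L | flat_subspaces V g L /\
     forall L', flat_subspaces V g L' -> (L <= L')%VS -> L' = L].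

(* A maximal element always exists, so the default value of [xget] is never
   used. *)
Lemma max_flat_ex (R : realType) (n b : nat) (W : Type)
    (V : set ('cV[R]_n * 'cV[bool]_b))
    (g : 'cV[R]_n -> 'cV[bool]_b -> W -> \bar R) :
  exists L, max_flat V g L.
Proof.
pose P k := `[< exists2 L, flat_subspaces V g L & \dim L = k >].
have P0 : exists k, P k.
  exists 0%N; apply/asboolP; exists 0%VS; last exact: dimv0.
  by move=> z _ xi /=; rewrite memv0 => /eqP ->; rewrite /flat_set /= addr0.
have Pb k : P k -> (k <= \dim {:'cV[R]_n})%N.
  by move=> /asboolP[L _ <-]; apply: dimvS; apply: subvf.
case: (ex_maxnP P0 Pb) => k /asboolP[L LV Lk] kmax.
exists L; split => // L' L'V LL'; apply/esym/eqP.
rewrite eqEdim LL' Lk /=; apply: kmax; apply/asboolP; by exists L'.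
Qed.

(* The value is in \bar R because the maximum over A = set0 is -oo; then every
   subspace is flat and the support rank of set0 is 0. *)
Definition max_constraint (R : realType) (n b r : nat) (W : Type)
    (f : 'cV[R]_n -> 'cV[bool]_b -> W -> 'cV[R]_r) (A : {set 'I_r})
    (x : 'cV[R]_n) (y : 'cV[bool]_b) (w : W) : \bar R :=
  \big[maxe/-oo%E]_(j in A) (f x y w j ord0)%:E.

Definition support_space (R : realType) (n b r : nat) (W : Type)
    (V : set ('cV[R]_n * 'cV[bool]_b))
    (f : 'cV[R]_n -> 'cV[bool]_b -> W -> 'cV[R]_r) (A : {set 'I_r}) :
    {vspace 'cV[R]_n} :=
  xget 0%VS (max_flat V (max_constraint f A)).

Definition support_rank (R : realType) (n b r : nat) (W : Type)
    (V : set ('cV[R]_n * 'cV[bool]_b))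
    (f : 'cV[R]_n -> 'cV[bool]_b -> W -> 'cV[R]_r) (A : {set 'I_r}) : nat :=
  (n - \dim (support_space V f A))%N.

(* Main.v *)
Require Import Defs.
From HB Require Import structures.
From mathcomp Require Import all_boot all_order all_algebra.
From mathcomp Require Import all_classical all_reals all_analysis.

From mathcomp Require Import lra zify.

Set Implicit Arguments.
Unset Strict Implicit.
Unset Printing Implicit Defensive.

Import Order.TTheory GRing.Theory Num.Theory.
Import numFieldNormedType.Exports.

Local Open Scope classical_set_scope.
Local Open Scope ring_scope.

(** A subspace [L] is flat for [max_(j in A) f_j] when this maximum does not
    change along [x + L], for every feasible [x].  Each [f_j] with [j] in [A] is
    then bounded above on the affine space [x + L], and a convex function which
    is bounded above on an affine space is constant on it.  So flatness for the
    maximum is flatness for every single [f_j] ([flat_subspaces_maxP]).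

    Flat subspaces are moreover stable under sums: [x + xi1 + xi2] is the
    midpoint of [x + 2 xi1] and [x + 2 xi2], where [f_j] equals [f_j x], so
    [f_j] is bounded above on [x + (L1 + L2)], hence constant there.  A maximal
    flat subspace is therefore the greatest one, and the flat subspaces for [A]
    are exactly the subspaces of [support_space V f A] ([sub_support_spaceP]).

    Together these two facts turn unions of index sets into intersections of
    support spaces ([support_spaceU]).  The rest is linear algebra: [j] adds to
    the rank of [A] the codimension of [L_A :&: L_j] in [L_A], which by the
    dimension formula is [\dim (L_A + L_j) - \dim L_j]; it decreases with [L_A],
    that is, when [A] grows. *)

Lemma convex_function_le (R : realFieldType) (E : lmodType R) (u : E -> R)
    (t : R) (x y : E) :
  @convex_function R E [set: E] u -> 0 <= t -> t <= 1 ->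
  u (t *: x + (1 - t) *: y) <= t * u x + (1 - t) * u y.
Proof.
by move=> cu t0 t1; apply: (cu (Itv01 t0 t1)); rewrite inE.
Qed.

(** If [u] increased strictly from [x] to [x + v], convexity would make it grow
    at least linearly along the ray beyond [x + v], against the bound. *)
Lemma convex_bounded_line_le (R : realFieldType) (E : lmodType R) (u : E -> R)
    (x v : E) (M : R) :
  @convex_function R E [set: E] u -> (forall t : R, u (x + t *: v) <= M) ->
  u (x + v) <= u x.
Proof.
move=> cu uM; rewrite leNgt; apply/negP => lt_u.
have uxM : u x <= M by have := uM 0; rewrite scale0r addr0.
have d_gt0 : 0 < u (x + v) - u x by rewrite subr_gt0.
(* Linear growth already exceeds [M] at the parameter [k]. *)
pose k := (M - u x) / (u (x + v) - u x) + 1.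
have k_ge1 : 1 <= k by rewrite lerDr divr_ge0 ?subr_ge0// ltW.
have k_gt0 : 0 < k by apply: lt_le_trans k_ge1.
have kd : k * (u (x + v) - u x) = M - u x + (u (x + v) - u x).
  by rewrite mulrDl mul1r divfK// gt_eqF.
have comb : k^-1 *: (x + k *: v) + (1 - k^-1) *: x = x + v.
  rewrite scalerDr scalerA mulVf ?gt_eqF// scale1r scalerBl scale1r.
  by rewrite addrC addrA subrK.
have kV_ge0 : 0 <= k^-1 by rewrite invr_ge0 ltW.
have kV_le1 : k^-1 <= 1 by rewrite invf_le1.
have := convex_function_le (x + k *: v) x cu kV_ge0 kV_le1.
rewrite comb -(ler_pM2l k_gt0) mulrDr !mulrA mulrBr mulr1 mulfV ?gt_eqF//.
by have := uM k; lra.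
Qed.

(** The reverse inequality is the previous lemma for the direction [- v] at
    [x + v]: both points play the same role on their line. *)
Lemma convex_bounded_flat (R : realFieldType) (E : vectType R) (u : E -> R)
    (L : {vspace E}) (x : E) (M : R) :
  @convex_function R E [set: E] u ->
  (forall xi, xi \in L -> u (x + xi) <= M) ->
  forall xi, xi \in L -> u (x + xi) = u x.
Proof.
move=> cu uM xi xiL; apply/eqP; rewrite eq_le; apply/andP; split.
  by apply: (@convex_bounded_line_le _ _ u _ _ M cu) => t; rewrite uM// memvZ.
rewrite -[x in u x <= _](addrK xi).
apply: (@convex_bounded_line_le _ _ u _ _ M cu) => t.
by rewrite -addrA uM// memvD// memvZ// memvN.
Qed.

(** Flat directions add up, by convexity at a midpoint; only flatness at the one
    base point [x] is available, so one cannot move along [L2] from a point of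
    [x + L1]. *)
Lemma convex_flat_addv (R : realFieldType) (E : vectType R) (u : E -> R)
    (L1 L2 : {vspace E}) (x : E) :
  @convex_function R E [set: E] u ->
  (forall xi, xi \in L1 -> u (x + xi) = u x) ->
  (forall xi, xi \in L2 -> u (x + xi) = u x) ->
  forall xi, xi \in (L1 + L2)%VS -> u (x + xi) = u x.
Proof.
move=> cu u1 u2; apply: (@convex_bounded_flat _ _ u _ x (u x) cu) => xi.
case/memv_addP => v1 v1L [v2 v2L ->].
have half (v : E) : 2^-1 *: (x + 2 *: v) = 2^-1 *: x + v.
  by rewrite scalerDr scalerA mulVf ?pnatr_eq0// scale1r.
have half2 : 1 - 2^-1 = 2^-1 :> R by lra.
have mid : 2^-1 *: (x + 2 *: v1) + (1 - 2^-1) *: (x + 2 *: v2) = x + (v1 + v2).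
  by rewrite half2 !half addrACA -scalerDl -{1}half2 subrK scale1r.
have := @convex_function_le R E u 2^-1 (x + 2 *: v1) (x + 2 *: v2) cu.
by rewrite mid (u1 (2 *: v1)) ?memvZ// (u2 (2 *: v2)) ?memvZ//; lra.
Qed.

Section SupportSpace.
Variables (R : realType) (n b r : nat) (W : Type).
Variables (V : set ('cV[R]_n * 'cV[bool]_b)).
Variables (f : 'cV[R]_n -> 'cV[bool]_b -> W -> 'cV[R]_r).
Hypothesis convexf : forall (j : 'I_r) (y : 'cV[bool]_b) (w : W),
  binary_part V y ->
  @convex_function R 'cV[R]_n [set: 'cV[R]_n] (fun x => f x y w j ord0).

Implicit Types (A B : {set 'I_r}) (L : {vspace 'cV[R]_n}) (j : 'I_r).

Local Notation flat_for A := (flat_subspaces V (max_constraint f A)).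
Local Notation supp A := (support_space V f A).

Lemma flat_subspaces_maxP A L :
  flat_for A L <->
  forall x y w, V (x, y) -> forall j, j \in A ->
    forall xi, xi \in L -> f (x + xi) y w j ord0 = f x y w j ord0.
Proof.
split=> [fL x y w Vxy j jA | fL [[x y] w] [/= Vxy _] xi xiL]; last first.
  by apply: eq_bigr => j jA; rewrite (fL x y w Vxy j jA xi xiL).
have le_max x' :
    ((f x' y w j ord0)%:E <= max_constraint f A x' y w)%E.
  exact: (@le_bigmax_cond _ _ _ _ _ (mem A) (fun i => (f x' y w i ord0)%:E)).
(* As [A] contains [j], the maximum at [x] is a real number, so it is an upper
   bound for the convex function [f_j] on [x + L]. *)
have max_fin : max_constraint f A x y w \is a fin_num.
  rewrite fin_numE; apply/andP; split.
    by rewrite -ltNye; apply: lt_le_trans (le_max x); rewrite ltNyr.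
  rewrite -ltey; apply/bigmax_ltP; split=> [|i _] //.
  exact: ltry.
apply: (@convex_bounded_flat _ _ (fun x => f x y w j ord0) L x
          (fine (max_constraint f A x y w))).
  by apply: convexf; exists x.
move=> xi xiL; rewrite -lee_fin fineK//.
by have := fL ((x, y), w) (conj Vxy I) xi xiL; rewrite /flat_set /= => <-.
Qed.

Lemma flat_subspaces_sub A L L' :
  (L <= L')%VS -> flat_for A L' -> flat_for A L.
Proof.
by move=> LL' fL' z Vz xi xiL; apply: fL' => //; apply: (subvP LL').
Qed.

Lemma flat_subspaces_addv A L1 L2 :
  flat_for A L1 -> flat_for A L2 -> flat_for A (L1 + L2)%VS.
Proof.
move=> /flat_subspaces_maxP f1 /flat_subspaces_maxP f2.
apply/flat_subspaces_maxP => x y w Vxy j jA.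
apply: (@convex_flat_addv _ _ (fun x => f x y w j ord0)).
- by apply: convexf; exists x.
- exact: f1.
- exact: f2.
Qed.

Lemma flat_subspacesU A B L :
  flat_for (A :|: B) L <-> flat_for A L /\ flat_for B L.
Proof.
split=> [/flat_subspaces_maxP fL |].
  split; apply/flat_subspaces_maxP => x y w Vxy j jAB;
    by apply: fL => //; rewrite inE jAB ?orbT.
move=> [/flat_subspaces_maxP fA /flat_subspaces_maxP fB].
apply/flat_subspaces_maxP => x y w Vxy j; rewrite inE => /orP[jA|jB].
  exact: fA.
exact: fB.
Qed.

(** A maximal flat subspace absorbs every other one, since their sum is flat;
    this makes the support space independent of the choice in its definition. *)
Lemma sub_support_spaceP A L : flat_for A L <-> (L <= supp A)%VS.
Proof.
have [flatS maxS] : max_flat V (max_constraint f A) (supp A).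
  exact: (xgetPex 0%VS (max_flat_ex V (max_constraint f A))).
split=> [flatL | /flat_subspaces_sub]; last exact.
rewrite -(maxS (supp A + L)%VS) ?addvSr ?addvSl//.
exact: flat_subspaces_addv.
Qed.

Lemma support_spaceU A B : supp (A :|: B) = (supp A :&: supp B)%VS.
Proof.
apply/eqP; rewrite eqEsubv subv_cap; apply/andP; split.
  have /flat_subspacesU[fA fB] : flat_for (A :|: B) (supp (A :|: B)).
    exact/sub_support_spaceP.
  by apply/andP; split; apply/sub_support_spaceP.
apply/sub_support_spaceP/flat_subspacesU.
by split; apply/sub_support_spaceP; rewrite ?capvSl ?capvSr.
Qed.

Lemma support_spaceS A B : A \subset B -> (supp B <= supp A)%VS.
Proof. by move=> /finset.setUidPr <-; rewrite support_spaceU capvSl. Qed.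

Lemma dim_support_space_le A : (\dim (supp A) <= n)%N.
Proof. by have := dimvS (subvf (supp A)); rewrite dimvf dim_matrix mulr1. Qed.

Lemma support_rank_mono A B :
  A \subset B -> (support_rank V f A <= support_rank V f B)%N.
Proof. by move=> /support_spaceS /dimvS; apply: leq_sub2l. Qed.

Lemma support_rank_submod A B j : A \subset B ->
  (support_rank V f (j |: B))%:Z - (support_rank V f B)%:Z
    <= (support_rank V f (j |: A))%:Z - (support_rank V f A)%:Z.
Proof.
move=> AB; rewrite /support_rank.
have := dim_support_space_le (j |: A); have := dim_support_space_le (j |: B).
have := dim_support_space_le A; have := dim_support_space_le B.
rewrite !support_spaceU.
have := dimv_sum_cap (supp [set j]) (supp A).
have := dimv_sum_cap (supp [set j]) (supp B).
have := dimvS (addvS (subvv (supp [set j])) (support_spaceS AB)).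
lia.
Qed.

End SupportSpace.

Theorem theorem2 (R : realType) (n b r : nat)
    (d : measure_display) (W : measurableType d) (P : probability W R)
    (V : set ('cV[R]_n * 'cV[bool]_b)) (c : 'cV[R]_n) (eps : R)
    (f : 'cV[R]_n -> 'cV[bool]_b -> W -> 'cV[R]_r)
    (eps01 : 0 < eps < 1)
    (compactV : compact V)
    (convexV : forall y : 'cV[bool]_b,
       @convex_set R 'cV[R]_n [set x | V (x, y)])
    (convexf : forall (j : 'I_r) (y : 'cV[bool]_b) (w : W),
       binary_part V y ->
       @convex_function R 'cV[R]_n [set: 'cV[R]_n] (fun x => f x y w j ord0)) :
  (forall A B : {set 'I_r}, A \subset B ->
     (support_rank V f A <= support_rank V f B)%N) /\
  (forall (A B : {set 'I_r}) (j : 'I_r), A \subset B -> j \notin B ->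
     (support_rank V f (j |: B))%:Z - (support_rank V f B)%:Z
       <= (support_rank V f (j |: A))%:Z - (support_rank V f A)%:Z).
Proof.
split=> [A B|A B j AB _]; first exact: support_rank_mono.
exact: support_rank_submod.
Qed.
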